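(* Let $P\subset\mathbb{Z}^n$ be a polymatroid with ground set $[n]$ and rank function $f$, and let $t\ge 1$ be any fixed real number. Then the polynomial $\mathcal{J}_P(x,t)$ in $x$ and the polynomial $\mathcal{J}_P(t,y)$ in $y$ are both interpolating.
   Context: Let $n$ be a positive integer, $[n]=\{1,\dots,n\}$, and let $\mathbf{e}_1,\dots,\mathbf{e}_n$ be the canonical basis of $\mathbb{R}^n$. A (integer) polymatroid $P$ with ground set $[n]$ is given by its rank function $f:2^{[n]}\to\mathbb{Z}$, which satisfies $f(\emptyset)=0$ and submodularity: $f(I)+f(J)\ge f(I\cup J)+f(I\cap J)$ for all $I,J\subseteq[n]$. Its set of bases is $$PB=\Big\{\mathbf{a}\in\mathbb{Z}^n : \sum_{i\in I}a_i\le f(I)\text{ for all } I\subseteq[n],\ \sum_{i\in[n]}a_i=f([n])\Big\}.$$ For $\mathbf{a}\in PB$, an index $i\in[n]$ is internally active if $\mathbf{a}-\mathbf{e}_i+\mathbf{e}_j\notin PB$ for every $j<i$, and externally active if $\mathbf{a}+\mathbf{e}_i-\mathbf{e}_j\notin PB$ for every $j<i$. Let $Int(\mathbf{a})$ and $Ext(\mathbf{a})$ denote the sets of internally and externally active indices with respect to $\mathbf{a}$. The polymatroid Tutte polynomial is $$\mathcal{J}_P(x,y)=\sum_{\mathbf{a}\in PB}x^{oi(\mathbf{a})}y^{oe(\mathbf{a})}(x+y-1)^{ie(\mathbf{a})},$$ where $oi(\mathbf{a})=|Int(\mathbf{a})\setminus Ext(\mathbf{a})|$, $oe(\mathbf{a})=|Ext(\mathbf{a})\setminus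 Int(\mathbf{a})|$, $ie(\mathbf{a})=|Int(\mathbf{a})\cap Ext(\mathbf{a})|$. The support of a polynomial $g(x)=\sum_{i=0}^m c_ix^i$ with real coefficients is $\{i: c_i\ne0\}$. The polynomial $g$ is called interpolating if its support is an integer interval $[n_1,n_2]$, consisting of all integers from $n_1$ to $n_2$ inclusive. *)

(* Defs.v *)
From mathcomp Require Import all_boot all_order all_algebra.
From mathcomp Require Import boolp classical_sets cardinality fsbigop reals.

Set Implicit Arguments.
Unset Strict Implicit.
Unset Printing Implicit Defensive.

Import Order.TTheory GRing.Theory Num.Theory.
Local Open Scope ring_scope.

(* The ground set [n] is 'I_n = {0, ..., n.-1}, with its usual order. The rank
   function is not required to be monotone or nonnegative. *)
Record polymatroid (n : nat) := Polymatroid {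
  rank :> {set 'I_n} -> int;
  rank_set0 : rank finset.set0 = 0;
  rank_submod : forall I J : {set 'I_n},
    rank (I :|: J) + rank (I :&: J) <= rank I + rank J
}.

Section Polymatroid.
Variables (n : nat) (P : polymatroid n).
Implicit Types (a : 'rV[int]_n) (i j : 'I_n).

Definition is_base a : bool :=
  [forall I : {set 'I_n}, \sum_(i in I) a 0 i <= P I]
  && (\sum_i a 0 i == P finset.setT).

Definition bases : set 'rV[int]_n := [set a | is_base a]%classic.

Definition unit_vec i : 'rV[int]_n := delta_mx 0 i.

Definition int_active a : {set 'I_n} :=
  [set i : 'I_n | [forall j : 'I_n,
     (j < i)%N ==> ~~ is_base (a - unit_vec i + unit_vec j)]].

Definition ext_active a : {set 'I_n} :=
  [set i : 'I_n | [forall j : 'I_n,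
     (j < i)%N ==> ~~ is_base (a + unit_vec i - unit_vec j)]].

Definition oi a : nat := #|int_active a :\: ext_active a|.
Definition oe a : nat := #|ext_active a :\: int_active a|.
Definition ie a : nat := #|int_active a :&: ext_active a|.

(* In {poly {poly R}}, the outer indeterminate 'X stands for x and the inner one
   'Y = 'X%:P stands for y. The \sum_(a \in A) of fsbigop is the sum over a
   classical set, meaningful for finitely supported summands: see
   finite_bases. *)
Definition tutte (R : comNzRingType) : {poly {poly R}} :=
  let x : {poly {poly R}} := 'X in
  let y : {poly {poly R}} := 'Y in
  \sum_(a \in bases) x ^+ oi a * y ^+ oe a * (x + y - 1) ^+ ie a.

Lemma finite_bases : finite_set bases.
Proof.
pose lo i : int := P finset.setT - P (~: [set i]).
pose N := (\max_i `|(P [set i] - lo i)%R|%N).+1.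
pose g (k : {ffun 'I_n -> 'I_N}) : 'rV[int]_n := \row_i (lo i + (k i : nat)%:Z).
apply: (@sub_finite_set _ _ (g @` [set: {ffun 'I_n -> 'I_N}])%classic); last first.
  by apply: finite_image; exact: finite_finset.
move=> a /andP[/forallP le_aP /eqP sum_a].
have hi_a i : a 0 i <= P [set i] by have := le_aP [set i]; rewrite big_set1.
have lo_a i : lo i <= a 0 i.
  rewrite /lo lerBlDr -sum_a (bigD1 i) //= lerD2l.
  by rewrite (le_trans _ (le_aP (~: [set i]))) // (eq_bigl (mem (~: [set i]))) // => j;
     rewrite !inE.
exists [ffun i => inord `|(a 0 i - lo i)%R|%N] => //.
apply/rowP => i; rewrite mxE ffunE inordK.
  by rewrite gez0_abs ?subr_ge0 ?lo_a // addrC subrK.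
rewrite ltnS (leq_trans _ (leq_bigmax i)) //.
rewrite -lez_nat !gez0_abs ?subr_ge0 ?lo_a ?lerD2r ?hi_a //.
exact: le_trans (lo_a i) (hi_a i).
Qed.

End Polymatroid.

Definition eval_x (R : comNzRingType) (t : R) (u : {poly {poly R}}) : {poly R} :=
  u.[t%:P].

Definition eval_y (R : comNzRingType) (t : R) (u : {poly {poly R}}) : {poly R} :=
  map_poly (horner_eval t) u.

(* The interval is nonempty, so the zero polynomial is not interpolating. *)
Definition interpolating (R : realType) (g : {poly R}) : Prop :=
  exists n1 n2 : nat, (n1 <= n2)%N /\
    forall i : nat, (g`_i != 0) = (n1 <= i <= n2)%N.

(* Main.v *)
Require Import Defs.
From mathcomp Require Import boolp classical_sets cardinality fsbigop.
From mathcomp Require Import all_boot all_order all_algebra finmap zify.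
From mathcomp Require Import reals.

Set Implicit Arguments.
Unset Strict Implicit.
Unset Printing Implicit Defensive.

Import Order.TTheory GRing.Theory Num.Theory.
Local Open Scope ring_scope.

(** The coefficients of [(x + t - 1) ^+ m] are nonnegative for [t >= 1], so no
    cancellation occurs in [J_P(x, t)] and its support is the union of the
    supports of the terms of the bases [a]. With [c = |Int(a)| = oi a + ie a],
    the term of [a] has support [{c}] if [t = 1] and the interval [[oi a, c]] if
    [t > 1]. Either way [c] belongs to it, so it suffices that the numbers
    [|Int(a)|] fill an interval: the intervals above all meet that interval,
    hence their union is an interval too (interpolating_sum).

    The numbers [|Int(a)|] turn out to be all the integers from their minimum
    up to [n] (base_int_active_card). The reason is that activity of [i] is a
    statement about slices: by the exchange property, [i] is internally active
    in [a] iff [a] minimizes the coordinate [i] among the bases agreeing with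
    [a] at all positions above [i] (int_active_minimal, exchange_lowers). In
    particular activity of [i] depends only on the coordinates of index at
    least [i] (int_active_local), so the coordinates can be adjusted from the
    last to the first: the number of inactive indices can be lowered to any
    smaller value by keeping or minimizing the coordinate [i] and recursing
    below [i] (base_inactive_below). The value [0] is reached, which gives [n].

    The statement in [y] follows from the one in [x] by duality: [a] is a base of
    [P] iff [- a] is a base of the polymatroid of rank function
    [I |-> f(~I) - f([n])], and the external activity of [a] is the internal
    activity of [- a]. *)

(* Elaboration leaves [reverse_coercion] in some implicit arguments; unfolding it
   lets [lia] identify convertible occurrences of atoms such as [P (~: I)]. *)
Ltac int_lia := cbv [reverse_coercion] in *; lia.

(** * Bases, tight sets and internal activity *)

Section Bases.
Variables (n : nat) (P : polymatroid n).
Implicit Types (a b c : 'rV[int]_n) (i j : 'I_n) (I J T : {set 'I_n}).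

Definition weight a I : int := \sum_(i in I) a 0 i.

Definition tight a I : bool := weight a I == P I.

Lemma is_baseP a :
  reflect ((forall I, weight a I <= P I) /\ weight a [set: 'I_n] = P [set: 'I_n])
          (is_base P a).
Proof.
apply: (iffP andP) => -[leP eqP'].
  split; first exact/forallP.
  by rewrite -(eqP eqP') /weight; apply: eq_bigl => i; rewrite inE.
split; first exact/forallP.
by rewrite -eqP' /weight; apply/eqP/eq_bigl => i; rewrite inE.
Qed.

Lemma weight0 a : weight a finset.set0 = 0.
Proof. by rewrite /weight big_set0. Qed.

Lemma weight_setC a I : weight a [set: 'I_n] = weight a I + weight a (~: I).
Proof.
rewrite /weight (bigID (mem I)) /=; congr (_ + _);
by apply: eq_bigl => i; rewrite !inE.
Qed.

Lemma weightUI a I J :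
  weight a (I :|: J) + weight a (I :&: J) = weight a I + weight a J.
Proof.
rewrite /weight !(big_mkcond (fun i => i \in _)) /=.
rewrite -!big_split /=; apply: eq_bigr => i _; rewrite !inE.
by case: (i \in I); case: (i \in J); rewrite /= ?addr0 ?add0r.
Qed.

Lemma weight_exchange a i j I :
  weight (a - unit_vec i + unit_vec j) I =
  weight a I - (i \in I)%:R + (j \in I)%:R.
Proof.
have weight_unit k : weight (unit_vec k) I = (k \in I)%:R.
  rewrite /weight big_mkcond (bigD1 k) //= big1 => [|l lk].
    by rewrite mxE !eqxx addr0; case: (k \in I).
  by rewrite mxE (negPf lk) andbF if_same.
rewrite -!weight_unit /weight -sumrB -big_split /=.
by apply: eq_bigr => k _; rewrite !mxE.
Qed.

(** Uncrossing: the slacks [P I - weight a I] are nonnegative and submodular,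
    so those of the union and the intersection vanish with those of [I] and
    [J]. *)
Lemma tightU a I J : is_base P a -> tight a I -> tight a J -> tight a (I :|: J).
Proof.
move=> /is_baseP[le_aP _] /eqP tI /eqP tJ.
have := rank_submod P I J; have := weightUI a I J.
have := le_aP (I :|: J); have := le_aP (I :&: J).
rewrite /tight; int_lia.
Qed.

(** The exchange keeps the total weight and increases by one the weight of the
    sets containing [j] but not [i], so only a tight one of these can forbid it. *)
Lemma exchange_blocked a i j :
  is_base P a -> ~~ is_base P (a - unit_vec i + unit_vec j) ->
  exists T, [/\ tight a T, j \in T & i \notin T].
Proof.
move=> /is_baseP[le_aP sum_a] notB.
have [I gtI] : exists I, P I < weight (a - unit_vec i + unit_vec j) I.
  apply/existsP; apply: contraR notB => /existsPn leI; apply/is_baseP; split.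
    by move=> I; rewrite leNgt leI.
  by rewrite weight_exchange sum_a !inE subrK.
exists I; have := le_aP I; move: gtI; rewrite weight_exchange /tight.
by case: (i \in I); case: (j \in I) => /= gtI leI; split=> //; int_lia.
Qed.

(** The union of the tight sets that block the exchanges of [i] with each
    [j < i] is a single certificate of activity. *)
Lemma int_active_tight a i : is_base P a -> i \in int_active P a ->
  exists T, [/\ tight a T, i \notin T & forall j : 'I_n, (j < i)%N -> j \in T].
Proof.
move=> Ba; rewrite inE => /forallP acti.
have blk j : exists T, [/\ tight a T, i \notin T & (j < i)%N -> j \in T].
  have [ltji|_] := ltnP j i; last first.
    by exists finset.set0; rewrite /tight weight0 rank_set0 inE.
  by have [T [tT jT iT]] := exchange_blocked Ba (implyP (acti j) ltji); exists T.
have [F FP] := choice blk.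
exists (\bigcup_j F j); split.
- elim/big_ind: _ => [|I J tI tJ|j _]; last by case: (FP j).
    by rewrite /tight weight0 rank_set0.
  exact: tightU.
- by apply/bigcupP => -[j _]; apply/negP; case: (FP j).
- by move=> j ltji; apply/bigcupP; exists j => //; case: (FP j) => _ _ ->.
Qed.

(** A tight set [T] certifying that [i] is active has maximal weight in [a]
    among all bases, so its complement has minimal weight; on this complement
    [c] can differ from [a] only at [i]. *)
Lemma int_active_minimal a c i : is_base P a -> is_base P c ->
  i \in int_active P a -> (forall j : 'I_n, (i < j)%N -> c 0 j = a 0 j) ->
  a 0 i <= c 0 i.
Proof.
move=> Ba Bc acti eq_ca; have [T [/eqP tT iT ltT]] := int_active_tight Ba acti.
have /is_baseP[_ sum_a] := Ba; have /is_baseP[le_cP sum_c] := Bc.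
have : weight c (~: T) - weight a (~: T) = c 0 i - a 0 i.
  rewrite /weight -sumrB (bigD1 i) ?inE //= big1 ?addr0 // => j.
  rewrite inE => /andP[jT ji]; rewrite eq_ca ?subrr // ltn_neqAle eq_sym.
  by rewrite ji leqNgt; apply: contra jT; exact: ltT.
have := le_cP T; have := weight_setC a T; have := weight_setC c T; int_lia.
Qed.

Lemma exchange_lowers a i j : (j < i)%N ->
  (a - unit_vec i + unit_vec j) 0 i = a 0 i - 1 /\
  forall k : 'I_n, (i < k)%N -> (a - unit_vec i + unit_vec j) 0 k = a 0 k.
Proof.
move=> ltji; rewrite !mxE !eqxx /= (gtn_eqF ltji : (i == j) = false) addr0.
split=> // k ltik; rewrite !mxE eqxx /= (gtn_eqF ltik : (k == i) = false).
by rewrite (gtn_eqF (ltn_trans ltji ltik) : (k == j) = false) subr0 addr0.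
Qed.

(** An exchange at [i] allowed in [b] would give a base agreeing with [a] above
    [i] but with a smaller coordinate [i]. *)
Lemma int_active_local a b i : is_base P a -> is_base P b ->
  (forall j : 'I_n, (i <= j)%N -> b 0 j = a 0 j) ->
  i \in int_active P a -> i \in int_active P b.
Proof.
move=> Ba Bb eq_ba acti; rewrite inE; apply/forallP => j; apply/implyP => ltji.
apply/negP => Bc; have [ci ck] := exchange_lowers b ltji.
suff: a 0 i <= b 0 i - 1 by rewrite eq_ba //; int_lia.
rewrite -ci; apply: int_active_minimal => // k ltik.
by rewrite ck // eq_ba // ltnW.
Qed.

Lemma base_lower_bound a i :
  is_base P a -> P [set: 'I_n] - P (~: [set i]) <= a 0 i.
Proof.
move=> /is_baseP[le_aP sum_a].
have := le_aP (~: [set i]); have := weight_setC a [set i].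
have : weight a [set i] = a 0 i by rewrite /weight big_set1.
int_lia.
Qed.

(** As long as [i] is inactive, some exchange lowers the coordinate [i] without
    changing those above; base_lower_bound makes this stop. *)
Lemma exists_int_active a i : is_base P a ->
  exists b, [/\ is_base P b, i \in int_active P b
              & forall j : 'I_n, (i < j)%N -> b 0 j = a 0 j].
Proof.
have [N] : exists N : nat, a 0 i - (P [set: 'I_n] - P (~: [set i])) <= N.
  by eexists; apply: lez_abs.
elim: N a => [|N IH] a leN Ba;
  (have [acti|] := boolP (i \in int_active P a); first by exists a);
  rewrite inE => /forallPn[j]; rewrite negb_imply negbK => /andP[ltji Bc].
- by have := base_lower_bound i Bc; rewrite (exchange_lowers a ltji).1; int_lia.
have [ci ck] := exchange_lowers a ltji.
have [|b [Bb actb eqb]] := IH _ _ Bc; first by rewrite ci; int_lia.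
by exists b; split=> // k ltik; rewrite eqb // ck.
Qed.

(** * The numbers of active indices *)

Definition inactive_below m a : {set 'I_n} :=
  [set i : 'I_n | (i < m)%N && (i \notin int_active P a)].

(** Descending coordinate by coordinate: since the coordinates from [m] on are
    kept, the recursive call at [m] does not disturb the activity of [m]. The
    index [m] has to be made active only when [k = 0]. *)
Lemma base_inactive_below m a k : is_base P a -> (k <= #|inactive_below m a|)%N ->
  exists b, [/\ is_base P b, forall i : 'I_n, (m <= i)%N -> b 0 i = a 0 i
              & #|inactive_below m b| = k].
Proof.
elim: m a k => [|m IH] a k Ba lek.
  have i0 : inactive_below 0 a = finset.set0 by apply/setP => i; rewrite !inE.
  by exists a; split=> //; move: lek; rewrite i0 cards0 leqn0 => /eqP ->.
have [ltmn|lenm] := ltnP m n; last first.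
  have iS c : inactive_below m.+1 c = inactive_below m c.
    apply/setP => i; rewrite !inE; have /= lti := leq_trans (ltn_ord i) lenm.
    by rewrite lti (ltnW _).
  rewrite iS in lek; have [b [Bb eqb cb]] := IH a k Ba lek.
  by exists b; split=> [//|i /ltnW/eqb //|]; rewrite iS.
pose i := Ordinal ltmn.
have iS c : #|inactive_below m.+1 c| =
    ((i \notin int_active P c) + #|inactive_below m c|)%N.
  rewrite (cardsD1 i) !inE ltnSn; congr (_ + _)%N; apply: eq_card => j.
  rewrite !inE ltnS leq_eqVlt -val_eqE /=.
  by case: ltngtP.
have [acti|inacti] := boolP (i \in int_active P a).
  rewrite iS acti in lek; have [b [Bb eqb cb]] := IH a k Ba lek.
  exists b; split=> [//|j /ltnW/eqb //|].
  by rewrite iS (@int_active_local a b i Ba Bb eqb acti).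
(* If [k > 0], the index [i] remains as one of the [k] inactive ones. *)
have [k0|k_gt0] := posnP k; last first.
  rewrite iS inacti -(ltn_predK k_gt0) ltnS in lek.
  have [b [Bb eqb cb]] := IH a k.-1 Ba lek.
  exists b; split=> [//|j /ltnW/eqb //|]; rewrite iS cb.
  suff -> : i \notin int_active P b by exact: (ltn_predK k_gt0).
  apply: contra inacti; apply: int_active_local => // j leij.
  by rewrite eqb.
have [c [Bc actc eqc]] := exists_int_active i Ba.
have [b [Bb eqb cb]] := IH c 0 Bc isT.
exists b; split=> [//|j ltij|]; first by rewrite eqb ?eqc // ltnW.
by rewrite iS cb (@int_active_local c b i Bc Bb eqb actc) k0.
Qed.

Lemma base_int_active_card a k : is_base P a ->
  (#|int_active P a| <= k <= n)%N ->
  exists b, is_base P b /\ #|int_active P b| = k.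
Proof.
have cardE c : (#|int_active P c| + #|inactive_below n c|)%N = n.
  rewrite -[RHS]card_ord -(cardC (mem (int_active P c))); congr (_ + _)%N.
  by apply: eq_card => i; rewrite inE ltn_ord.
move=> Ba /andP[leak lekn].
have [|b [Bb _ cb]] := @base_inactive_below n a (n - k) Ba.
  by have := cardE a; lia.
by exists b; split=> //; have := cardE b; lia.
Qed.

(** The greedy vector, of entries the increments of [P] along the initial
    segments: by submodularity these increments are at most the increments
    obtained inside any [I]. *)
Lemma exists_base : exists a, is_base P a.
Proof.
pose init m : {set 'I_n} := [set i : 'I_n | (i < m)%N].
pose a : 'rV[int]_n := \row_i (P (init i.+1) - P (init i)).
have init0 : init 0 = finset.set0 by apply/setP => i; rewrite !inE.
have initn : init n = [set: 'I_n] by apply/setP => i; rewrite !inE ltn_ord.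
have initS (i : 'I_n) : init i.+1 = i |: init i.
  by apply/setP => j; rewrite !inE ltnS leq_eqVlt.
have weightS I (i : 'I_n) : weight a (I :&: init i.+1) =
    weight a (I :&: init i) + (if i \in I then a 0 i else 0).
  have [iI|iI] := boolP (i \in I).
    rewrite /weight (big_setD1 i) /=; last by rewrite !inE iI ltnSn.
    rewrite addrC; congr (_ + _); apply: eq_bigl => j.
    by rewrite !inE ltnS leq_eqVlt -val_eqE; case: ltngtP; rewrite ?andbF.
  rewrite addr0; congr (weight a _); apply/setP => j.
  by rewrite initS !inE; case: eqP => // ->; rewrite (negPf iI).
exists a; apply/is_baseP.
have main m : (m <= n)%N -> weight a (init m) = P (init m) /\
    forall I, weight a (I :&: init m) <= P (I :&: init m).
  elim: m => [_|m IH ltmn].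
    rewrite init0 weight0 rank_set0; split=> // I.
    by rewrite finset.setI0 weight0 rank_set0.
  have [eqm leI] := IH (ltnW ltmn); pose i := Ordinal ltmn.
  have aiE : a 0 i = P (init m.+1) - P (init m) by rewrite mxE.
  split=> [|I].
    have := weightS [set: 'I_n] i; rewrite !finset.setTI inE /= eqm aiE; int_lia.
  rewrite (weightS I i); case: ifP => iI; last first.
    rewrite addr0; suff -> : I :&: init m.+1 = I :&: init m by exact: leI.
    by apply/setP => j; rewrite (initS i) !inE; case: eqP => // ->; rewrite iI.
  have := rank_submod P (I :&: init m.+1) (init m).
  have -> : (I :&: init m.+1) :|: init m = init m.+1.
    apply/setP => j; rewrite (initS i) !inE /=.
    by case: eqP => [->|]; rewrite ?iI //; case: (j \in I); rewrite ?orbb.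
  have -> : (I :&: init m.+1) :&: init m = I :&: init m.
    apply/setP => j; rewrite !inE -andbA; congr (_ && _).
    by rewrite ltnS; case: ltngtP.
  have := leI I; rewrite /= aiE; int_lia.
have [] := main n (leqnn n); rewrite initn => eqn leI.
by split=> // I; have := leI I; rewrite finset.setIT.
Qed.
End Bases.

(** * Duality between internal and external activity *)

Section Dual.
Variables (n : nat) (P : polymatroid n).

Let dual_rank (I : {set 'I_n}) : int := P (~: I) - P [set: 'I_n].

Lemma dual_rank0 : dual_rank finset.set0 = 0.
Proof. by rewrite /dual_rank finset.setC0 subrr. Qed.

Lemma dual_rank_submod I J :
  dual_rank (I :|: J) + dual_rank (I :&: J) <= dual_rank I + dual_rank J.
Proof.
rewrite /dual_rank finset.setCU finset.setCI.
have := rank_submod P (~: I) (~: J); int_lia.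
Qed.

Definition dual : polymatroid n := Polymatroid dual_rank0 dual_rank_submod.

Lemma is_base_dual a : is_base dual (- a) = is_base P a.
Proof.
have weightN I : weight (- a) I = - weight a I.
  by rewrite /weight -sumrN; apply: eq_bigr => i _; rewrite mxE.
apply/is_baseP/is_baseP; rewrite weightN /= /dual_rank finset.setCT rank_set0.
all: move=> [le_aP sum_a]; split=> [I|]; last by int_lia.
  have := le_aP (~: I); have := weight_setC a I.
  by rewrite weightN /= /dual_rank finset.setCK; int_lia.
have := le_aP (~: I); have := weight_setC a I.
by rewrite weightN /=; int_lia.
Qed.

Lemma int_active_dual a : int_active dual (- a) = ext_active P a.
Proof.
apply/setP => i; rewrite !inE; apply: eq_forallb => j.
by rewrite -is_base_dual !opprD opprK.
Qed.
End Dual.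

Lemma base_ext_active_card (n : nat) (P : polymatroid n) a k : is_base P a ->
  (#|ext_active P a| <= k <= n)%N ->
  exists b, is_base P b /\ #|ext_active P b| = k.
Proof.
rewrite -is_base_dual -int_active_dual => Ba lek.
have [b [Bb cb]] := base_int_active_card Ba lek.
by exists (- b); rewrite -is_base_dual -int_active_dual opprK.
Qed.

(** * Supports of sums of shifted powers of a linear polynomial *)

Section Interpolation.
Variables (R : realType) (T : eqType) (s : seq T).
Implicit Types (w : T -> R) (p r : T -> nat).

Lemma coef_linear_exp (c : R) m k :
  (('X + c%:P) ^+ m)`_k = c ^+ (m - k) *+ 'C(m, k).
Proof.
rewrite addrC exprDn.
have -> : \sum_(i < m.+1) (c%:P ^+ (m - i) * 'X ^+ i) *+ 'C(m, i) =
          \poly_(i < m.+1) (c ^+ (m - i) *+ 'C(m, i)).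
  rewrite poly_def; apply: eq_bigr => i _.
  by rewrite -polyC_exp mul_polyC scalerMnl.
rewrite coef_poly ltnS; case: leqP => // ltmk.
by rewrite bin_small.
Qed.

(** The support is nonempty, bounded by [N] and closed upwards below [N]: a
    degree beyond [p a + r a] is reached as the top degree of another term,
    and a degree between two degrees of one term is reached by this term. *)
Lemma interpolating_sum (c : R) w p r N :
  0 <= c -> (forall a, a \in s -> 0 < w a) ->
  (exists a, a \in s) -> (forall a, a \in s -> p a + r a <= N)%N ->
  (forall a k, a \in s -> (p a + r a <= k <= N)%N ->
     exists2 b, b \in s & (p b + r b)%N = k) ->
  interpolating (\sum_(a <- s) w a *: ('X ^+ p a * ('X + c%:P) ^+ r a)).
Proof.
move=> c_ge0 w_gt0 [a0 sa0] leN up; set g := \sum_(a <- s) _.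
(* The support of the term of [a]: only the top degree survives if [c = 0]. *)
pose term a k := (p a <= k <= p a + r a)%N && ((c != 0) || (k == p a + r a)%N).
have termP a k : a \in s ->
    0 <= (w a *: ('X ^+ p a * ('X + c%:P) ^+ r a))`_k /\
    (0 < (w a *: ('X ^+ p a * ('X + c%:P) ^+ r a))`_k) = term a k.
  move=> /w_gt0 wa; rewrite coefZ pmulr_rge0 // pmulr_rgt0 // coefXnM /term.
  case: ltnP => [//|lepk] /=; rewrite coef_linear_exp.
  split; first by rewrite mulrn_wge0 ?exprn_ge0.
  have [lekr|ltrk] := leqP k (p a + r a); last first.
    by rewrite bin_small ?mulr0n ?ltxx //; lia.
  rewrite pmulrn_lgt0 ?bin_gt0; last by lia.
  case: (ltgtP c 0) c_ge0 => // [c_gt0|->] _ /=; first by rewrite exprn_gt0.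
  rewrite expr0n; case: eqP => [|/eqP]; rewrite ?ltr01 ?ltxx; lia.
have suppP k : reflect (exists2 a, a \in s & term a k) (g`_k != 0).
  rewrite /g coef_sum big_seq psumr_neq0 => [|a /(termP _ k)[] //].
  apply: (iffP hasP) => -[a sa]; have [_ tE] := termP a k sa.
    by rewrite sa /= tE => tak; exists a.
  by rewrite -tE => ta_gt0; exists a; rewrite ?sa.
have c_in a : a \in s -> g`_(p a + r a) != 0.
  by move=> sa; apply/suppP; exists a => //; rewrite /term leq_addr leqnn eqxx orbT.
have supp_up k l : (k <= l <= N)%N -> g`_k != 0 -> g`_l != 0.
  move=> /andP[lekl lelN] /suppP[a sa tak].
  have [ltl|lel] := ltnP l (p a + r a); last first.
    have [|b sb <-] := up a l sa; first by rewrite lel.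
    exact: c_in.
  apply/suppP; exists a => //; move: tak; rewrite /term.
  case: (c != 0) => /=; lia.
have ex : exists k, g`_k != 0 by exists (p a0 + r a0)%N; exact: c_in.
case: (ex_minnP ex) => m gm min_m; exists m, N.
have supp_le k : g`_k != 0 -> (k <= N)%N.
  by move=> /suppP[a sa] /andP[/andP[_ lek] _]; exact: leq_trans lek (leN a sa).
split=> [|k]; first exact: supp_le.
apply/idP/idP => [gk|/andP[lemk lekN]]; first by rewrite min_m ?supp_le.
by apply: supp_up gm; rewrite lemk.
Qed.
End Interpolation.

(** * The two specializations of the Tutte polynomial *)

Section Specialization.
Variables (R : realType) (n : nat) (P : polymatroid n) (t : R).

Lemma eval_y_tutte : eval_y t (tutte P R) =
  \sum_(a <- fset_set (bases P))
    t ^+ oe P a *: ('X ^+ oi P a * ('X + (t - 1)%:P) ^+ ie P a).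
Proof.
rewrite /eval_y /tutte fsbig_finite; last exact: finite_bases.
rewrite rmorph_sum /=; apply: eq_bigr => a _.
rewrite !(rmorphM, rmorphXn, rmorphB, rmorphD, rmorph1) /= !map_polyX map_polyC /=.
rewrite /horner_eval hornerX -mul_polyC polyC_exp addrA mulrA.
by rewrite [_ * 'X^_]mulrC.
Qed.

Lemma eval_x_tutte : eval_x t (tutte P R) =
  \sum_(a <- fset_set (bases P))
    t ^+ oi P a *: ('X ^+ oe P a * ('X + (t - 1)%:P) ^+ ie P a).
Proof.
rewrite /eval_x /tutte fsbig_finite; last exact: finite_bases.
rewrite horner_sum; apply: eq_bigr => a _.
rewrite !(hornerM, horner_exp, hornerD, hornerN, hornerX, hornerC).
rewrite -mul_polyC polyC_exp polyCB mulrA addrA.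
by rewrite [t%:P + 'X]addrC.
Qed.
End Specialization.

Theorem theorem13 (R : realType) (n : nat) (n_gt0 : (0 < n)%N)
    (P : polymatroid n) (t : R) (t_ge1 : 1 <= t) :
  interpolating (eval_y t (tutte P R)) /\ interpolating (eval_x t (tutte P R)).
Proof.
have t_gt0 : 0 < t by exact: lt_le_trans ltr01 t_ge1.
have c_ge0 : 0 <= t - 1 by rewrite subr_ge0.
have memE a : (a \in fset_set (bases P)) = is_base P a.
  rewrite in_fset_set; last exact: finite_bases.
  by apply/idP/idP; rewrite mem_setE.
have [a0 Ba0] := exists_base P.
have card_le (A : {set 'I_n}) : (#|A| <= n)%N by rewrite -[leqRHS]card_ord max_card.
have intE a : (oi P a + ie P a)%N = #|int_active P a|.
  by rewrite addnC /oi /ie cardsID.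
have extE a : (oe P a + ie P a)%N = #|ext_active P a|.
  by rewrite addnC /oe /ie finset.setIC cardsID.
rewrite eval_y_tutte eval_x_tutte.
split; apply: (interpolating_sum (N := n) c_ge0).
- by move=> a _; exact: exprn_gt0.
- by exists a0; rewrite memE.
- by move=> a _; rewrite intE.
- move=> a k; rewrite memE intE => Ba /(base_int_active_card Ba)[b [Bb cb]].
  by exists b; rewrite ?memE ?intE.
- by move=> a _; exact: exprn_gt0.
- by exists a0; rewrite memE.
- by move=> a _; rewrite extE.
- move=> a k; rewrite memE extE => Ba /(base_ext_active_card Ba)[b [Bb cb]].
  by exists b; rewrite ?memE ?extE.
Qed.
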